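(* Let $\Gamma$ be an $n$-player game ($n\ge 2$) with finite pure strategy sets $S_1,\dots,S_n$ and payoff functions $A_1,\dots,A_n$. Consider the optimization problem in the variables $x^i_s,r^i_s,u^i_s,\overline{u}^i,f^i_s\in\mathbb{R}$ and $b^i_s\in\{0,1\}$ ($i\in[n]$, $s\in S_i$): $$\min\ \sum_{i=1}^n\sum_{s\in S_i}\big(f^i_s-U^i b^i_s\big)$$ subject to $\sum_{s\in S_i}x^i_s=1$ for all $i\in[n]$ and, for all $i\in[n]$ and $s\in S_i$, $$u^i_s=\sum_{\hat{\mathbf{s}}\in S_{-i}}\prod_{s_j\in\hat{\mathbf{s}}}x^j_{s_j}A_i[s,\hat{\mathbf{s}}],\qquad \overline{u}^i\ge u^i_s,\qquad r^i_s=\overline{u}^i-u^i_s,$$ $$x^i_s\le 1-b^i_s,\qquad x^i_s\ge 0,\qquad r^i_s\ge 0,\qquad f^i_s\ge r^i_s,\qquad f^i_s\ge U^i b^i_s.$$ The set of (mixed) Nash equilibria of $\Gamma$ minimizes the objective function of this problem; that is, every Nash equilibrium $\mathbf{x}=(x^i_s)_{i\in[n],s\in S_i}$, together with suitable values of the remaining variables $r^i_s,u^i_s,\overline{u}^i,f^i_s,b^i_s$, is a global minimizer of the problem.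
   Context: Let $[n]=\{1,\dots,n\}$ be the set of players. Player $i$ has a finite set $S_i$ of pure strategies. $S_{-i}=S_1\times\dots\times S_{i-1}\times S_{i+1}\times\dots\times S_n$ is the set of pure strategy tuples of all players other than $i$. The payoff function of player $i$ is $A_i:S_1\times\dots\times S_n\to\mathbb{R}$; for $s\in S_i$ and $\hat{\mathbf{s}}\in S_{-i}$, $A_i[s,\hat{\mathbf{s}}]$ is the payoff of player $i$ when $i$ plays $s$ and the others play $\hat{\mathbf{s}}$. For $\hat{\mathbf{s}}=(s_j)_{j\ne i}\in S_{-i}$, the notation $\prod_{s_j\in\hat{\mathbf{s}}}x^j_{s_j}$ means $\prod_{j\ne i}x^j_{s_j}$. The constant $U^i=\max_{s^l,s^h\in S_i,\ \hat{\mathbf{s}}^l,\hat{\mathbf{s}}^h\in S_{-i}}\big(A_i[s^h,\hat{\mathbf{s}}^h]-A_i[s^l,\hat{\mathbf{s}}^l]\big)$ is the maximum difference of any two payoffs of player $i$. A mixed strategy of player $i$ is a vector $\mathbf{x}^i=(x^i_s)_{s\in S_i}$ with $x^i_s\ge 0$ and $\sum_{s\in S_i}x^i_s=1$ (pure strategies are special cases). A mixed strategy profile is a tuple $\mathbf{x}=(\mathbf{x}^1,\dots,\mathbf{x}^n)$ of mixed strategies; player $i$'s expected payoff is $\mathbb{E}[A_i[\mathbf{x}]]=\sum_{s\in S_i}x^i_s\sum_{\hat{\mathbf{s}}\in S_{-i}}A_i[s,\hat{\mathbf{s}}]\prod_{s_j\in\hat{\mathbf{s}}}x^j_{s_j}$.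 A profile $\mathbf{x}$ is a (mixed) Nash equilibrium if for every player $i$ and every mixed strategy $\mathbf{y}^i$ of player $i$, $\mathbb{E}[A_i[\mathbf{x}]]\ge\mathbb{E}[A_i[\mathbf{y}^i,\mathbf{x}^{-i}]]$, where $(\mathbf{y}^i,\mathbf{x}^{-i})$ is $\mathbf{x}$ with $\mathbf{x}^i$ replaced by $\mathbf{y}^i$. *)

(* Defs.v *)
From HB Require Import structures.
From mathcomp Require Import all_boot all_order all_algebra reals.

Set Implicit Arguments.
Unset Strict Implicit.
Unset Printing Implicit Defensive.

Import Order.TTheory GRing.Theory Num.Theory.
Local Open Scope ring_scope.

Section Game.
Variables (R : realType) (n : nat) (S : 'I_n -> finType).

Definition profile := {dffun forall j : 'I_n, S j}.

(* S_{-i} *)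
Definition others (i : 'I_n) :=
  {dffun forall j : {j : 'I_n | j != i}, S (val j)}.

(* The pure profile [s, t], where i plays s and the others play t. *)
Definition with_others (i : 'I_n) (s : S i) (t : others i) : profile :=
  [ffun j : 'I_n =>
     match eqVneq j i with
     | EqNotNeq e => ecast k (S k) (esym e) s
     | NeqNotEq ne => t (exist _ j ne)
     end].

Lemma with_others_self (i : 'I_n) (s : S i) (t : others i) :
  with_others s t i = s.
Proof. by rewrite ffunE; case: eqVneq => [e|/eqP//]; rewrite eq_axiomK. Qed.

Lemma with_others_other (i : 'I_n) (s : S i) (t : others i)
    (j : {j : 'I_n | j != i}) : with_others s t (val j) = t j.
Proof.
rewrite ffunE; case: eqVneq => [e|ne]; first by case/eqP: (valP j).
by case: j ne => j p ne; rewrite (bool_irrelevance p ne).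
Qed.

Variable A : 'I_n -> profile -> R.

(* The terms with h = l are 0, so starting the maximum at 0 does not change its
   value when there is at least one profile. *)
Definition payoff_range (i : 'I_n) : R :=
  \big[Num.max/0]_(h : S i * others i) \big[Num.max/0]_(l : S i * others i)
    (A i (with_others h.1 h.2) - A i (with_others l.1 l.2)).

Definition is_mixed (i : 'I_n) (y : S i -> R) : Prop :=
  (forall s, 0 <= y s) /\ \sum_s y s = 1.

Definition others_weight (x : forall i, S i -> R) (i : 'I_n) (t : others i) : R :=
  \prod_(j : {j : 'I_n | j != i}) x (val j) (t j).

Definition expected_payoff (i : 'I_n) (x : forall i, S i -> R) : R :=
  \sum_(s : S i) x i s *
    \sum_(t : others i) A i (with_others s t) * others_weight x t.

Definition is_nash (x : forall i, S i -> R) : Prop :=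
  (forall i, is_mixed (x i)) /\
  (forall (i : 'I_n) (y : S i -> R), is_mixed y ->
     expected_payoff i (dfwith x y) <= expected_payoff i x).

Record mip_point := MipPoint {
  mip_x : forall i, S i -> R;
  mip_r : forall i, S i -> R;
  mip_u : forall i, S i -> R;
  mip_ubar : 'I_n -> R;
  mip_f : forall i, S i -> R;
  mip_b : forall i, S i -> bool
}.

Definition mip_objective (p : mip_point) : R :=
  \sum_(i < n) \sum_(s : S i) (mip_f p s - payoff_range i * (mip_b p s)%:R).

Record mip_feasible (p : mip_point) : Prop := MipFeasible {
  mip_x_sum : forall i, \sum_(s : S i) mip_x p s = 1;
  mip_uE : forall i (s : S i),
    mip_u p s =
      \sum_(t : others i) others_weight (mip_x p) t * A i (with_others s t);
  mip_ubar_ge : forall i (s : S i), mip_u p s <= mip_ubar p i;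
  mip_rE : forall i (s : S i), mip_r p s = mip_ubar p i - mip_u p s;
  mip_x_le : forall i (s : S i), mip_x p s <= 1 - (mip_b p s)%:R;
  mip_x_ge0 : forall i (s : S i), 0 <= mip_x p s;
  mip_r_ge0 : forall i (s : S i), 0 <= mip_r p s;
  mip_f_ge_r : forall i (s : S i), mip_r p s <= mip_f p s;
  mip_f_ge_b : forall i (s : S i),
    payoff_range i * (mip_b p s)%:R <= mip_f p s
}.

Definition mip_global_minimizer (p : mip_point) : Prop :=
  mip_feasible p /\
  (forall q, mip_feasible q -> mip_objective p <= mip_objective q).

End Game.

(* Main.v *)
Require Import Defs.
From mathcomp Require Import all_boot all_order all_algebra reals.

(**
Every feasible point has a nonnegative objective because f >= U b termwise, so
it suffices to reach 0.  Given an equilibrium, let ubar be the equilibrium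
payoff, b mark the strategies of weight 0, and f = U b.  Comparing with pure
deviations gives u_s <= ubar, and since ubar is the x-average of the u_s, the
regret vanishes on the support of x; elsewhere it is at most U because ubar and
u_s are both averages of payoffs.
*)

Set Implicit Arguments.
Unset Strict Implicit.
Unset Printing Implicit Defensive.

Import Order.TTheory GRing.Theory Num.Theory.
Local Open Scope ring_scope.

(** Distributivity of a product over sums whose index types vary with the factor; it makes the
    product weights on [others S i] sum to 1. *)
Lemma sum_dffun_prod (R : comNzRingType) (I : finType) (T : I -> finType)
    (P : forall i, T i -> R) :
  \sum_(t : {dffun forall i, T i}) \prod_i P i (t i) =
  \prod_i \sum_(s : T i) P i s.
Proof.
(* The sum moves to [fprod T] and from there to functions into the tagged union, where
   [bigA_distr_big_dep] applies; [big_tag] then returns to each [T i]. *)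
transitivity (\sum_(t : fprod T) \prod_(i in I) [ffun s => P i s] (t i)).
  rewrite (reindex _ (onW_bij _ (@dffun_of_fprod_bij I T))) /=.
  by apply: eq_bigr => t _; apply: eq_bigr => i _; rewrite !ffunE.
rewrite (@big_fprod _ _ _ _ _ _ _ (fun i => [ffun s => P i s])).
rewrite -(bigA_distr_big_dep _ (fun i g => untag 0 [ffun s => P i s] g)).
apply: eq_bigr => i _.
rewrite -(@big_tag _ _ _ _ _ (fun i (s : T i) => [ffun s => P i s] s)).
by apply: eq_bigr => s _; rewrite ffunE.
Qed.

Section Game.
Variables (R : realType) (n : nat) (S : 'I_n -> finType).
Variable A : 'I_n -> profile S -> R.
Implicit Types (x : forall i, S i -> R) (i : 'I_n).

(** The inner sum of [expected_payoff], with the factors in the same order, so that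
    [expected_payoffE] holds by conversion. It does not involve [x i], so a deviation of player [i]
    leaves it unchanged. *)
Definition pure_payoff x i (s : S i) : R :=
  \sum_(t : others S i) A i (with_others s t) * others_weight x t.

Lemma expected_payoffE x i :
  expected_payoff A i x = \sum_(s : S i) x i s * pure_payoff x s.
Proof. by []. Qed.

Lemma others_weight_ge0 x i (t : others S i) :
  (forall j (s : S j), 0 <= x j s) -> 0 <= others_weight x t.
Proof. by move=> x_ge0; apply: prodr_ge0 => j _. Qed.

Lemma sum_others_weight x i :
  (forall j, \sum_(s : S j) x j s = 1) ->
  \sum_(t : others S i) others_weight x t = 1.
Proof.
move=> x_sum; rewrite /others_weight.
rewrite (sum_dffun_prod (fun j : {j : 'I_n | j != i} => x (val j))).
by apply: big1 => j _.
Qed.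

Lemma others_weight_dfwith x i (y : S i -> R) (t : others S i) :
  others_weight (dfwith x y) t = others_weight x t.
Proof.
by apply: eq_bigr => j _; rewrite dfwith_out // eq_sym (valP j).
Qed.

Lemma expected_payoff_dfwith x i (y : S i -> R) :
  expected_payoff A i (dfwith x y) = \sum_(s : S i) y s * pure_payoff x s.
Proof.
apply: eq_bigr => s _; rewrite dfwith_in; congr (_ * _).
by apply: eq_bigr => t _; rewrite others_weight_dfwith.
Qed.

Lemma payoff_range_ge0 i : 0 <= payoff_range A i.
Proof. exact: bigmax_ge_id. Qed.

Lemma payoff_diff_le i (s s' : S i) (t t' : others S i) :
  A i (with_others s t) - A i (with_others s' t') <= payoff_range A i.
Proof.
apply: (bigmax_sup (s, t)) => //.
exact: (bigmax_sup (s', t')).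
Qed.

(** Both payoffs average over the same distribution on [others S i], so the bound can be checked for
    each [t]. *)
Lemma pure_payoff_diff_le x i (s s' : S i) :
  (forall j, is_mixed (x j)) ->
  pure_payoff x s - pure_payoff x s' <= payoff_range A i.
Proof.
move=> x_mixed; rewrite -[leRHS]mulr1.
rewrite -(@sum_others_weight x i) => [|j]; last by case: (x_mixed j).
rewrite mulr_sumr -sumrB; apply: ler_sum => t _; rewrite -mulrBl.
apply: ler_wpM2r; last exact: payoff_diff_le.
by apply: others_weight_ge0 => j; case: (x_mixed j).
Qed.

Lemma pure_payoff_le_nash x i (s : S i) :
  is_nash A x -> pure_payoff x s <= expected_payoff A i x.
Proof.
case=> _ /(_ i (fun s' => (s' == s)%:R)) nash.
(* Used twice for the point mass at [s]: to evaluate the deviation payoff and, with [F] constantly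
   1, to get total mass 1. *)
have sumE (F : S i -> R) : \sum_s' (s' == s)%:R * F s' = F s.
  rewrite (bigD1 s) //= eqxx mul1r big1 ?addr0 // => s' /negbTE ->.
  by rewrite mul0r.
rewrite expected_payoff_dfwith sumE in nash; apply: nash; split=> [s'|].
  exact: ler0n.
by rewrite -[RHS](sumE (fun=> 1)); apply: eq_bigr => s' _; rewrite mulr1.
Qed.

Lemma regret_average x i c :
  is_mixed (x i) ->
  \sum_(s : S i) x i s * (c - pure_payoff x s) = c - expected_payoff A i x.
Proof.
case=> _ x_sum; rewrite expected_payoffE -[c in RHS]mul1r -x_sum mulr_suml.
by rewrite -sumrB; apply: eq_bigr => s _; rewrite mulrBr.
Qed.

(** Nonnegative terms, weight times regret, sum to 0, so each of them vanishes. *)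
Lemma nash_regret_support x i (s : S i) :
  is_nash A x -> x i s != 0 -> expected_payoff A i x - pure_payoff x s = 0.
Proof.
move=> nash; have x_mixed := nash.1 i.
have /psumr_eq0P H : forall s' : S i, true ->
    0 <= x i s' * (expected_payoff A i x - pure_payoff x s').
  move=> s' _; rewrite mulr_ge0 ?subr_ge0 ?pure_payoff_le_nash //.
  by case: x_mixed.
have /eqP := H (etrans (regret_average _ x_mixed) (subrr _)) s isT.
by rewrite mulf_eq0 => /orP[->|/eqP].
Qed.

Lemma regret_le_payoff_range x i (s : S i) :
  (forall j, is_mixed (x j)) ->
  expected_payoff A i x - pure_payoff x s <= payoff_range A i.
Proof.
(* Taking [c] to be [payoff_range A i + pure_payoff x s] turns the goal into nonnegativity of an
   average over [s']. *)
move=> x_mixed; rewrite lerBlDr -subr_ge0 -regret_average //.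
apply: sumr_ge0 => s' _; apply: mulr_ge0; first by case: (x_mixed i).
by rewrite subr_ge0 -lerBlDr pure_payoff_diff_le.
Qed.

Lemma mip_objective_ge0 (q : mip_point R S) :
  mip_feasible A q -> 0 <= mip_objective A q.
Proof.
move=> q_feas; apply: sumr_ge0 => i _; apply: sumr_ge0 => s _.
by rewrite subr_ge0 (mip_f_ge_b q_feas).
Qed.

End Game.

Theorem proposition4 (R : realType) (n : nat) (n_ge2 : (2 <= n)%N)
    (S : 'I_n -> finType) (A : 'I_n -> profile S -> R)
    (x : forall i : 'I_n, S i -> R) :
  is_nash A x ->
  exists (r u : forall i : 'I_n, S i -> R) (ubar : 'I_n -> R)
         (f : forall i : 'I_n, S i -> R) (b : forall i : 'I_n, S i -> bool),
    mip_global_minimizer A (MipPoint x r u ubar f b).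
Proof.
move=> nash; have x_mixed := nash.1.
pose ubar i := expected_payoff A i x.
exists (fun i s => ubar i - pure_payoff A x s), (fun i s => pure_payoff A x s).
exists ubar, (fun i s => payoff_range A i * (x i s == 0)%:R).
exists (fun i s => x i s == 0).
split; last first.
  move=> q /mip_objective_ge0; apply: le_trans.
  rewrite /mip_objective big1 // => i _; rewrite big1 // => s _ /=.
  by rewrite subrr.
split=> //= i; first by case: (x_mixed i).
- by move=> s; apply: eq_bigr => t _; rewrite mulrC.
- by move=> s; apply: pure_payoff_le_nash.
(* If [b] is 1, both sides are 0; otherwise a single weight is at most the total mass. *)
- move=> s; case: eqVneq => [->|_]; first by rewrite subrr.
  case: (x_mixed i) => x_ge0 x_sum.
  by rewrite subr0 -x_sum (bigD1 s) //= lerDl sumr_ge0.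
- by case: (x_mixed i).
- by move=> s; rewrite subr_ge0; apply: pure_payoff_le_nash.
(* Off the support [f] is U, which bounds every regret; on it [f] is 0, so the regret has to
   vanish. *)
- move=> s; case: eqVneq => [_|x_neq0].
    by rewrite mulr1; apply: regret_le_payoff_range.
  by rewrite mulr0 /ubar nash_regret_support.
Qed.
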